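(* With any constant step size $\eta_k=\eta>0$, the policy generated by TD-NPG converges to some optimal policy: there is an optimal policy $\pi^*$ such that $\pi_k\to\pi^*$ as $k\to\infty$ (that is, $\pi_k(a|s)\to\pi^*(a|s)$ for all $(s,a)$).
   Context: MDP: $\mathcal{S},\mathcal{A}$ are finite nonempty sets (states, actions), $P(\cdot|s,a)$ is a transition kernel, $r:\mathcal{S}\times\mathcal{A}\to[0,1]$ is the reward, $\gamma\in[0,1)$. $\Delta(\mathcal{A})$ is the probability simplex on $\mathcal{A}$. A policy $\pi$ assigns $\pi(\cdot|s)\in\Delta(\mathcal{A})$ to each $s$. $V^\pi(s)=\mathbb{E}[\sum_{t\ge0}\gamma^t r(s_t,a_t)\mid s_0=s,\pi]$ with $a_t\sim\pi(\cdot|s_t)$, $s_{t+1}\sim P(\cdot|s_t,a_t)$; $V^*(s)=\max_\pi V^\pi(s)$; $\pi$ is optimal if $V^\pi=V^*$ (optimal policies need not be unique). The Bellman operator is $\mathcal{T}^\pi V(s)=\mathbb{E}_{a\sim\pi(\cdot|s),s'\sim P(\cdot|s,a)}[r(s,a)+\gamma V(s')]$. TD-NPG with constant step size $\eta>0$ (temporal-difference policy mirror descent with mirror map $h(p)=\sum_a p_a\log p_a$): the inputs are an initial state value estimation $V^0$, which can be any vector in $\mathbb{R}^{|\mathcal{S}|}$, and an initial policy $\pi_0$, which can be any policy ($V^0$ is not necessarily the state value of $\pi_0$). For $k=0,1,2,\dots$ set $Q^k(s,a)=r(s,a)+\gamma\mathbb{E}_{s'\sim P(\cdot|s,a)}[V^k(s')]$;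 $$\pi_{k+1}(a|s)=\frac{\pi_k(a|s)\exp\{\eta Q^k(s,a)\}}{\sum_{a'\in\mathcal{A}}\pi_k(a'|s)\exp\{\eta Q^k(s,a')\}};$$ $V^{k+1}=\mathcal{T}^{\pi_{k+1}}V^k$. All quantities are computed exactly.
   Formalization: The initial policy is assumed to have full support, $\pi_0(a|s)>0$ for all $(s,a)$; for an arbitrary initial policy the claim fails (one state, two actions, $r=(0,1)$, $\pi_0=(1,0)$ gives $\pi_k=\pi_0$, not optimal). *)

(* Defs.v *)
From HB Require Import structures.
From mathcomp Require Import all_boot all_order all_algebra.
From mathcomp Require Import all_classical all_reals all_analysis.

Set Implicit Arguments.
Unset Strict Implicit.
Unset Printing Implicit Defensive.

Import Order.TTheory GRing.Theory Num.Theory numFieldNormedType.Exports.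

Local Open Scope classical_set_scope.
Local Open Scope ring_scope.

Definition is_dist (R : realType) (T : finType) (p : T -> R) : Prop :=
  (forall x, 0 <= p x) /\ \sum_x p x = 1.

Record mdp (R : realType) (S A : finType) := MDP {
  trans : S -> A -> S -> R;
  reward : S -> A -> R;
  discount : R;
  trans_dist : forall s a, is_dist (trans s a);
  reward_itv : forall s a, 0 <= reward s a <= 1;
  discount_itv : 0 <= discount < 1 }.

Definition is_policy (R : realType) (S A : finType) (pi : S -> A -> R) : Prop :=
  forall s, is_dist (pi s).

(* [rollout M pi s] is a probability space carrying a random trajectory
   s_0, a_0, s_1, a_1, ... with s_0 = s, a_t ~ pi(.|s_t) and
   s_{t+1} ~ P(.|s_t, a_t); its law is given on cylinders.  The law is only
   prescribed when [pi] is a policy, so that rollouts can be indexed by all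
   functions [pi]; [rollout_exists] below shows that they exist. *)
Record rollout (R : realType) (S A : finType) (M : mdp R S A)
    (pi : S -> A -> R) (s : S) := Rollout {
  rollout_disp : measure_display;
  sample_space : measurableType rollout_disp;
  rollout_prob : probability sample_space R;
  state_at : nat -> sample_space -> S;
  action_at : nat -> sample_space -> A;
  measurable_state_at : forall t x, measurable [set w | state_at t w = x];
  measurable_action_at : forall t a, measurable [set w | action_at t w = a];
  rollout_law : is_policy pi ->
    forall (n : nat) (x : nat -> S) (a : nat -> A),
    rollout_prob [set w | forall t, (t <= n)%N ->
                    state_at t w = x t /\ action_at t w = a t] =
    ((x 0%N == s)%:R *
     (\prod_(t < n.+1) pi (x t) (a t)) *
     \prod_(t < n) trans M (x t) (a t) (x t.+1))%:E }.

Arguments state_at {R S A M pi s} _ _ _.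
Arguments action_at {R S A M pi s} _ _ _.

Section MDPTheory.
Context (R : realType) (S A : finType) (M : mdp R S A).

Definition discounted_return (pi : S -> A -> R) (s : S) (X : rollout M pi s)
    (w : sample_space X) : R :=
  limn (series (fun t => discount M ^+ t *
                         reward M (state_at X t w) (action_at X t w))).

Arguments discounted_return [_ _] _ _.

(* The return lies in [0, 1/(1 - discount)], so [fine] loses nothing. *)
Definition value (X : forall pi s, rollout M pi s) (pi : S -> A -> R) (s : S)
    : R :=
  fine 'E_(rollout_prob (X pi s))[discounted_return (X pi s)].

Definition opt_value (X : forall pi s, rollout M pi s) (s : S) : R :=
  sup [set value X pi s | pi in @is_policy R S A].

Definition optimal (X : forall pi s, rollout M pi s) (pi : S -> A -> R) : Prop :=
  is_policy pi /\ forall s, value X pi s = opt_value X s.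

Definition qvalue (V : S -> R) (s : S) (a : A) : R :=
  reward M s a + discount M * \sum_s' trans M s a s' * V s'.

Definition bellman (pi : S -> A -> R) (V : S -> R) (s : S) : R :=
  \sum_a pi s a *
    \sum_s' trans M s a s' * (reward M s a + discount M * V s').

Definition npg_update (eta : R) (Q pi : S -> A -> R) (s : S) (a : A) : R :=
  pi s a * expR (eta * Q s a) / \sum_b pi s b * expR (eta * Q s b).

Fixpoint td_npg (eta : R) (pi0 : S -> A -> R) (V0 : S -> R) (k : nat)
    : (S -> A -> R) * (S -> R) :=
  if k is k'.+1 then
    let: (pi, V) := td_npg eta pi0 V0 k' in
    let pi' := npg_update eta (qvalue V) pi in
    (pi', bellman pi' V)
  else (pi0, V0).

End MDPTheory.

(* Existence of rollouts: the trajectory is a function of one uniform variable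
   u in [0, 1[, by inverse transform sampling; after each draw, the position of
   u inside its cell, rescaled to [0, 1[, serves for the next draw. *)
Section Sampling.
Context (R : realType) (T : finType) (p : T -> R) (x0 : T).
Hypothesis hp : is_dist p.

Definition cdf (x : T) : R := \sum_(y | (enum_rank y < enum_rank x)%N) p y.

Definition in_cell (u : R) (x : T) : bool := (cdf x <= u) && (u < cdf x + p x).

Definition draw (u : R) : T := odflt x0 [pick x | in_cell u x].

Lemma cdf_ge0 x : 0 <= cdf x.
Proof. by apply: sumr_ge0 => y _; apply: (hp.1 y). Qed.

Lemma cdfD x : cdf x + p x = \sum_(y | (enum_rank y <= enum_rank x)%N) p y.
Proof.
rewrite [RHS](bigD1 x) //= addrC; congr (_ + _); apply: eq_bigl => y.
by rewrite ltn_neqAle andbC; congr (_ && _); rewrite -(inj_eq enum_rank_inj).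
Qed.

Lemma cdfD_le1 x : cdf x + p x <= 1.
Proof.
rewrite cdfD -hp.2 [leRHS](bigID (fun y => enum_rank y <= enum_rank x)%N) /=.
by rewrite lerDl; apply: sumr_ge0 => y _; apply: (hp.1 y).
Qed.

Lemma cdf_mono x y : (enum_rank x < enum_rank y)%N -> cdf x + p x <= cdf y.
Proof.
move=> xy; rewrite cdfD /cdf.
rewrite [leRHS](bigID (fun z => enum_rank z <= enum_rank x)%N) /=.
rewrite [X in _ <= X + _](_ : _ = \sum_(z | (enum_rank z <= enum_rank x)%N) p z).
  by rewrite lerDl; apply: sumr_ge0 => z _; apply: (hp.1 z).
apply: eq_bigl => z; apply/idP/idP => [/andP[]//|zx].
by rewrite zx andbT (leq_ltn_trans zx).
Qed.

Lemma in_cell_inj u x y : in_cell u x -> in_cell u y -> x = y.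
Proof.
move=> /andP[x1 x2] /andP[y1 y2].
case: (ltngtP (enum_rank x) (enum_rank y)) => [xy|yx|e].
- by move: (le_lt_trans (le_trans (cdf_mono xy) y1) x2); rewrite ltxx.
- by move: (le_lt_trans (le_trans (cdf_mono yx) x1) y2); rewrite ltxx.
- exact/enum_rank_inj/val_inj.
Qed.

Lemma in_cell_ex u : 0 <= u < 1 -> exists x, in_cell u x.
Proof.
move=> /andP[u0 u1].
have T0 : (0 < #|T|)%N by apply/card_gt0P; exists x0.
have lt_last : (#|T|.-1 < #|T|)%N by rewrite prednK.
pose z : T := enum_val (Ordinal lt_last).
have hz : u < cdf z + p z.
  rewrite cdfD (eq_bigl xpredT) ?hp.2 // => y.
  by rewrite /z enum_valK /= -ltnS prednK ?ltn_ord.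
pose P x := u < cdf x + p x.
case: (@arg_minnP _ z P (fun x => enum_rank x) hz) => x Px xmin.
exists x; rewrite /in_cell [X in _ && X]Px andbT.
have [e|x_gt0] := posnP (enum_rank x).
  by rewrite /cdf big_pred0 // => y; rewrite e.
have lt : ((enum_rank x).-1 < #|T|)%N.
  by rewrite (leq_ltn_trans (leq_pred _)).
pose y : T := enum_val (Ordinal lt).
have yr : enum_rank y = (enum_rank x).-1 :> nat by rewrite /y enum_valK.
have -> : cdf x = cdf y + p y.
  rewrite cdfD /cdf; apply: eq_bigl => w.
  by rewrite yr -[in RHS]ltnS prednK.
rewrite leNgt; apply/negP => /xmin; rewrite yr.
by rewrite leqNgt prednK // leqnn.
Qed.

Lemma drawP u x : 0 <= u < 1 -> draw u = x <-> in_cell u x.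
Proof.
move=> /in_cell_ex[y uy]; rewrite /draw; case: pickP => [z uz|/(_ y)] /=.
  by split=> [<-//|ux]; apply: in_cell_inj uz ux.
by rewrite uy.
Qed.

Lemma rescale_itv u x : in_cell u x -> 0 <= (u - cdf x) / p x < 1.
Proof.
move=> /andP[x1 x2].
have px : 0 < p x by rewrite -(ltrD2l (cdf x)) addr0; apply: le_lt_trans x2.
by rewrite divr_ge0 ?(ltW px) ?subr_ge0//= ltr_pdivrMr// mul1r ltrBlDl.
Qed.

Lemma rescale_cell u x (l w : R) : 0 <= l -> 0 <= w -> l + w <= 1 ->
  (in_cell u x /\ l <= (u - cdf x) / p x < l + w) <->
  cdf x + p x * l <= u < cdf x + p x * l + p x * w.
Proof.
move=> l0 w0 lw; have := hp.1 x; rewrite le_eqVlt => /predU1P[px|px].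
  rewrite /in_cell -px !mul0r !addr0; split.
    by move=> [/andP[a b]] _; move: (le_lt_trans a b); rewrite ltxx.
  by move=> /andP[a b]; move: (le_lt_trans a b); rewrite ltxx.
rewrite ler_pdivlMr// ltr_pdivrMr// lerBrDl ltrBlDl !(mulrC (p x)).
rewrite -addrA -mulrDl; split=> [[_ //]|/andP[a b]].
rewrite a b; split => //; apply/andP; split.
  by apply: le_trans a; rewrite lerDl mulr_ge0 // ltW.
by apply: (lt_le_trans b); rewrite lerD2l ler_piMl // ltW.
Qed.

End Sampling.

Section UnitMeasure.
Context (R : realType).

Definition unit_measure :=
  mrestr (@lebesgue_measure R) (measurable_itv `[0 : R, 1[).

HB.instance Definition _ := Measure.on unit_measure.

Lemma unit_measure_setT : unit_measure setT = 1%E.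
Proof.
by rewrite /unit_measure /mrestr setTI lebesgue_measure_itv /= lte01 sube0.
Qed.

HB.instance Definition _ :=
  Measure_isProbability.Build _ _ _ unit_measure unit_measure_setT.

End UnitMeasure.

Section RolloutExists.
Context (R : realType) (S A : finType) (M : mdp R S A).
Context (pi : S -> A -> R) (a0 : A).
Hypothesis hpi : is_policy pi.

Fixpoint sample_path (n : nat) (s : S) (u : R) : S * A :=
  let a := draw (pi s) a0 u in
  if n is n'.+1 then
    let v := (u - cdf (pi s) a) / pi s a in
    let s' := draw (trans M s a) s v in
    sample_path n' s' ((v - cdf (trans M s a) s') / trans M s a s')
  else (s, a).

Lemma sample_path_cylinder (n : nat) (x : nat -> S) (a : nat -> A) :
  let w := (\prod_(t < n.+1) pi (x t) (a t)) *
           \prod_(t < n) trans M (x t) (a t) (x t.+1) in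
  0 <= w /\
  exists2 l, 0 <= l /\ l + w <= 1 & forall u, 0 <= u < 1 ->
    ((forall t, (t <= n)%N -> sample_path t (x 0%N) u = (x t, a t)) <->
     l <= u < l + w).
Proof.
elim: n x a => [|n IH] x a /=.
  rewrite big_ord1 big_ord0 mulr1; split; first exact: (hpi _).1.
  exists (cdf (pi (x 0%N)) (a 0%N)).
    by split; [exact: cdf_ge0 | exact: cdfD_le1].
  move=> u u01; rewrite -[X in _ <-> X]/(is_true (in_cell _ _ _)).
  rewrite -(drawP a0 (hpi _) _ u01); split=> [/(_ _ (leqnn _))[]//|e t].
  by rewrite leqn0 => /eqP->/=; rewrite e.
have [w0 [l [l0 lw] H]] := IH (x \o succn) (a \o succn).
set w := _ * _ in w0 lw H.
set p := pi (x 0%N) (a 0%N).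
set q := trans M (x 0%N) (a 0%N) (x 1%N).
have -> : (\prod_(t < n.+2) pi (x t) (a t)) *
    \prod_(t < n.+1) trans M (x t) (a t) (x t.+1) = p * (q * w).
  by rewrite big_ord_recl [X in _ * X]big_ord_recl mulrACA -mulrA.
have p0 : 0 <= p by exact: (hpi _).1.
have q0 : 0 <= q by exact: (trans_dist _ _ _).1.
have hP := trans_dist M (x 0%N) (a 0%N).
clearbody w.
split; first by rewrite !mulr_ge0.
set d := cdf (trans M (x 0%N) (a 0%N)) (x 1%N).
set c := cdf (pi (x 0%N)) (a 0%N).
have d0 : 0 <= d by exact: cdf_ge0.
have c0 : 0 <= c by exact: cdf_ge0.
have m0 : 0 <= d + q * l by rewrite addr_ge0 // mulr_ge0.
have mw : d + q * l + q * w <= 1.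
  apply: le_trans (cdfD_le1 hP (x 1%N)); rewrite -/d -/q -addrA -mulrDr lerD2l.
  by rewrite ler_piMr.
exists (c + p * (d + q * l)).
  split; first by rewrite addr_ge0 // mulr_ge0.
  apply: le_trans (cdfD_le1 (hpi (x 0%N)) (a 0%N)); rewrite -/c -/p -addrA -mulrDr.
  by rewrite lerD2l ler_piMr.
move=> u u01.
have qw0 : 0 <= q * w by exact: mulr_ge0.
have := rescale_cell (hpi (x 0%N)) u (a 0%N) m0 qw0 mw.
rewrite -/c -/p => <-.
have := rescale_cell hP ((u - c) / p) (x 1%N) l0 w0 lw.
rewrite -/d -/q => <-.
split=> [Hu|[Hu [Hv Hw]] t].
  have /= [ea] := Hu 0%N isT.
  have := Hu 1%N isT; rewrite /= ea => -[es _].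
  have Hua := (drawP a0 (hpi _) (a 0%N) u01).1 ea.
  have v01 := rescale_itv Hua.
  have Hvs := (drawP (x 0%N) hP (x 1%N) v01).1 es.
  do 2![split=> //]; apply/(H _ (rescale_itv Hvs)) => t tn.
  by have := Hu t.+1 tn; rewrite /= ea es.
have ea := (drawP a0 (hpi _) (a 0%N) u01).2 Hu.
have v01 := rescale_itv Hu.
have es := (drawP (x 0%N) hP (x 1%N) v01).2 Hv.
case: t => [|t] tn /=; rewrite ea //= es.
exact: (H _ (rescale_itv Hv)).2 Hw t tn.
Qed.

Lemma measurable_cell (T : finType) (p : T -> R) (x : T) :
  measurable [set u : R | in_cell p u x].
Proof.
rewrite [X in measurable X](_ : _ = `[cdf p x, cdf p x + p x[%classic) //.
Qed.

Lemma measurable_rescale (c p : R) (E : set R) : measurable E ->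
  measurable [set u : R | E ((u - c) / p)].
Proof.
move=> mE; rewrite -[X in measurable X]setTI.
have : measurable_fun [set: R] (fun u : R => (u - c) / p).
  by apply: measurable_realfun.measurable_funM => //; apply: measurable_realfun.measurable_funB.
by apply.
Qed.

Lemma measurable_sample_path (n : nat) (s : S) (z : S * A) :
  measurable [set u : R | 0 <= u < 1 /\ sample_path n s u = z].
Proof.
have mI : measurable [set u : R | 0 <= u < 1].
  rewrite [X in measurable X](_ : _ = `[0, 1[%classic) //.
elim: n s z => [|n IH] s z /=.
  have [e|e] := eqVneq z.1 s; last first.
    rewrite [X in measurable X](_ : _ = set0) //.
    by apply/seteqP; split=> u //= -[_ zE]; move: e; rewrite -zE eqxx.
  have := measurableI _ _ mI (measurable_cell (pi s) z.2).
  congr measurable; apply/seteqP; split=> u /= [u01 h]; split=> //.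
    by rewrite (drawP a0 (hpi s) z.2 u01).2 // -e -surjective_pairing.
  by apply/(drawP a0 (hpi s) z.2 u01); rewrite -h.
pose F (y : A * S) : set R :=
  [set u | 0 <= u < 1] `&` [set u | in_cell (pi s) u y.1] `&`
  [set u | in_cell (trans M s y.1) ((u - cdf (pi s) y.1) / pi s y.1) y.2] `&`
  [set u | let v := (u - cdf (pi s) y.1) / pi s y.1 in
     let v' := (v - cdf (trans M s y.1) y.2) / trans M s y.1 y.2 in
     0 <= v' < 1 /\ sample_path n y.2 v' = z].
have mF y : measurable (F y).
  apply: measurableI; first apply: measurableI; first apply: measurableI.
  - exact: mI.
  - exact: measurable_cell.
  - apply: (measurable_rescale _ _ (E := [set v | in_cell _ v y.2])).
    exact: measurable_cell.
  - apply: (measurable_rescale _ _ (E := [set v |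
      let v' := (v - cdf (trans M s y.1) y.2) / trans M s y.1 y.2 in
      0 <= v' < 1 /\ sample_path n y.2 v' = z])).
    exact: (measurable_rescale _ _ (IH y.2 z)).
have := fin_bigcup_measurable (@finite_finset _ [set: A * S]) (fun y _ => mF y).
congr measurable; apply/seteqP; split=> u /=.
  move=> [[a s'] _ [[[/= u01 ua] vs] [_ h]]]; split=> //.
  have v01 := rescale_itv ua.
  rewrite (drawP a0 (hpi s) a u01).2 //.
  by rewrite (drawP s (trans_dist M s a) s' v01).2.
move=> [u01]; set a := draw (pi s) a0 u; set v := (u - _) / _.
set s' := draw _ s v.
move=> h; exists (a, s') => //.
have ua : in_cell (pi s) u a by exact/(drawP a0 (hpi s) a u01).
have v01 := rescale_itv ua.
have vs : in_cell (trans M s a) v s' by exact/(drawP s (trans_dist M s a) s' v01).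
by split; last by split=> //; exact: rescale_itv vs.
Qed.

Definition sample_rollout (s : S) (u : R) (t : nat) : S * A :=
  if 0 <= u < 1 then sample_path t s u else (s, a0).

Lemma measurable_sample_rollout (s : S) (t : nat) (Z : set (S * A)) :
  measurable [set u : R | Z (sample_rollout s u t)].
Proof.
have mI' : measurable [set u : R | 0 <= u < 1].
  rewrite [X in measurable X](_ : _ = `[0, 1[%classic) //.
have mZ z : measurable [set u : R | sample_rollout s u t = z].
  have m1 := measurable_sample_path t s z.
  have [e|e] := eqVneq (s, a0) z.
    have := measurableU _ _ m1 (measurableC mI').
    congr measurable; apply/seteqP; split=> u /=; rewrite /sample_rollout.
      by case=> [[-> //]|/negP/negbTE->].
    by case: ifPn => [u01 h|u01 _]; [left|right; exact/negP].
  move: m1; congr measurable; apply/seteqP; split=> u /=; rewrite /sample_rollout.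
    by case=> ->.
  by case: ifPn => // _ h; rewrite h eqxx in e.
have := fin_bigcup_measurable (@finite_finset _ Z) (fun z _ => mZ z).
congr measurable; apply/seteqP; split=> u /=; first by case=> z ? /= ->.
by move=> h; exists (sample_rollout s u t).
Qed.

Lemma sample_rollout_law (s : S) (n : nat) (x : nat -> S) (a : nat -> A) :
  unit_measure [set u | forall t, (t <= n)%N ->
    (sample_rollout s u t).1 = x t /\ (sample_rollout s u t).2 = a t] =
  ((x 0%N == s)%:R *
   (\prod_(t < n.+1) pi (x t) (a t)) *
   \prod_(t < n) trans M (x t) (a t) (x t.+1))%:E.
Proof.
rewrite /unit_measure /mrestr.
have [<-|e] := eqVneq (x 0%N) s; last first.
  rewrite !mul0r [X in lebesgue_measure X](_ : _ = set0) ?measure0 //.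
  apply/seteqP; split=> u //= -[/(_ 0%N isT)[]].
  rewrite /sample_rollout in_itv /= => + _ u01; rewrite u01 /= => h.
  by rewrite h eqxx in e.
rewrite mul1r.
have [w0 [l [l0 lw] H]] := sample_path_cylinder n x a.
set w := _ * _ in w0 lw H *.
rewrite [X in lebesgue_measure X](_ : _ = `[l, l + w[%classic).
  rewrite lebesgue_measure_itv /= lte_fin ltrDl -EFinD addrAC subrr add0r.
  by case: ltrP => // w_le0; congr EFin; apply/le_anti; rewrite w_le0 w0.
apply/seteqP; split=> u /=; rewrite !in_itv /=.
  move=> [h u01]; apply/(H u u01) => t /h[].
  by rewrite /sample_rollout u01 => <- <-; exact: surjective_pairing.
move=> /[dup] lu /andP[u1 u2].
have u01 : 0 <= u < 1 by rewrite (le_trans l0 u1) (lt_le_trans u2 lw).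
by split=> // t tn; rewrite /sample_rollout u01 ((H u u01).2 lu t tn).
Qed.

End RolloutExists.

Theorem rollout_exists (R : realType) (S A : finType) (M : mdp R S A)
    (pi : S -> A -> R) (s : S) :
  (0 < #|A|)%N -> inhabited (rollout M pi s).
Proof.
case/card_gt0P => a0 _; have [hpi|nhpi] := pselect (is_policy pi).
  exists; apply: (@Rollout _ _ _ M pi s _ _ (@unit_measure R)
    (fun t u => (sample_rollout M pi a0 s u t).1)
    (fun t u => (sample_rollout M pi a0 s u t).2)).
  - by move=> t x; exact: (measurable_sample_rollout M a0 hpi s t [set z | z.1 = x]).
  - by move=> t x; exact: (measurable_sample_rollout M a0 hpi s t [set z | z.2 = x]).
  - by move=> _; exact: sample_rollout_law.
exists; apply: (@Rollout _ _ _ M pi s _ _ (@unit_measure R)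
  (fun _ _ => s) (fun _ _ => a0)) => //.
- by move=> t x; have [e|/eqP e] := eqVneq s x;
    [rewrite [X in measurable X](_ : _ = setT)|
     rewrite [X in measurable X](_ : _ = set0)] => //; apply/seteqP; split.
- by move=> t x; have [e|/eqP e] := eqVneq a0 x;
    [rewrite [X in measurable X](_ : _ = setT)|
     rewrite [X in measurable X](_ : _ = set0)] => //; apply/seteqP; split.
Qed.

(* Main.v *)
(* Subtracting a constant from V^0 shifts every Q^k by a constant and leaves
   the policies unchanged, so one may assume V^0 <= T^{pi_0} V^0.  Then V^k is
   nondecreasing and bounded; let V be its limit and Q the limit of Q^k.
   An action a with Q(s,a) < max_b Q(s,b) loses mass geometrically, so the
   regrets x_k = sum_a pi_{k+1}(a|s) (max_b Q(s,b) - Q(s,a)) are summable; hence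
   V(s) = max_b Q(s,b), and the error e_k = max_s (V - V^k)(s) satisfies
   e_{k+1} <= gamma e_k + sum_s x_k(s), so it is summable too.
   Up to normalisation pi_k(a|s) is
   pi_0(a|s) exp(eta sum_{i<k} (Q^i(s,a) - V(s))), which is nonincreasing in k,
   and for a greedy action summability of the errors keeps it away from 0.  Thus
   pi_k converges to a policy pi with T^pi V = V, while T^{pi'} V <= V for every
   pi'.  Telescoping the discounted return along a trajectory turns these two
   relations into V^pi = V and V^{pi'} <= V. *)

Require Import Defs.
From mathcomp Require Import all_boot all_order all_algebra.
From mathcomp Require Import all_classical all_reals all_analysis.
From mathcomp Require Import measurable_realfun ring lra.

Set Implicit Arguments.
Unset Strict Implicit.
Unset Printing Implicit Defensive.

Import Order.TTheory GRing.Theory Num.Theory numFieldNormedType.Exports.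

Local Open Scope classical_set_scope.
Local Open Scope ring_scope.

(** * TD-NPG iterates *)

Section Sequences.
Context (R : realType).
Implicit Types u v e x : R^nat.

Lemma cvg_sumr (I : finType) (f : I -> R^nat) (l : I -> R) :
  (forall i, f i n @[n --> \oo] --> l i) ->
  \sum_i f i n @[n --> \oo] --> \sum_i l i.
Proof. by move=> fl; apply: cvg_big => [|i _]; [exact: add_continuous|]. Qed.

Lemma ler_wsum (I : finType) (p f : I -> R) (c : R) :
  is_dist p -> (forall i, f i <= c) -> \sum_i p i * f i <= c.
Proof.
move=> [p0 p1] fc; rewrite -[leRHS]mul1r -p1 mulr_suml.
by apply: ler_sum => i _; rewrite ler_wpM2l.
Qed.

Lemma summable_bounded u (C : R) : (forall n, 0 <= u n) ->
  (forall n, series u n <= C) -> cvgn (series u).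
Proof.
move=> u0 uC; apply: nondecreasing_is_cvgn.
  by apply/nondecreasing_seqP => n; rewrite seriesSr lerDl.
by exists C => _ [n _ <-].
Qed.

(* Potential: [series u n + u n / (1 - rho)] eventually decreases. *)
Lemma eventually_geometric_bounded u (rho : R) : rho < 1 ->
  (forall n, 0 <= u n) -> (\forall n \near \oo, u n.+1 <= rho * u n) ->
  exists C, forall n, series u n <= C.
Proof.
move=> rho1 u0 [N _ uN]; have r0 : 0 < 1 - rho by rewrite subr_gt0.
exists (series u N + u N / (1 - rho)) => n.
have [nN|/ltnW Nn] := leqP n N.
  apply: (@le_trans _ _ (series u N)); last first.
    by rewrite lerDl divr_ge0 // ltW.
  by move: n N nN {uN}; apply/nondecreasing_seqP => n; rewrite seriesSr lerDl.
suff : series u n + u n / (1 - rho) <= series u N + u N / (1 - rho).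
  by apply: le_trans; rewrite lerDl divr_ge0 // ltW.
elim: n Nn => [|n IH]; first by rewrite leqn0 => /eqP ->.
rewrite leq_eqVlt => /predU1P[->//|Nn]; apply: le_trans (IH Nn).
rewrite seriesSr -addrA lerD2l -[X in X + _](mulfK (lt0r_neq0 r0)) -mulrDl.
by rewrite ler_pM2r ?invr_gt0 //; have := uN n Nn; lra.
Qed.

Lemma contraction_bounded e x (g C : R) : g < 1 -> (forall n, 0 <= e n) ->
  (forall n, e n.+1 <= g * e n + x n) -> (forall n, series x n <= C) ->
  exists C', forall n, series e n <= C'.
Proof.
move=> g1 e0 ex xC; have g0 : 0 < 1 - g by rewrite subr_gt0.
exists ((e 0%N + C) / (1 - g)) => n; rewrite ler_pdivlMr //.
(* Summing the recursion over k < n shifts the index of [e] on the left, which leaves the boundary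
   terms [e n] and [e 0]. *)
suff H : series e n * (1 - g) + e n <= e 0%N + series x n.
  by have := xC n; have := e0 n; lra.
elim: n => [|n IH]; first by rewrite !seriesEord /= !big_ord0 mul0r addr0 add0r.
by rewrite !seriesSr; have := ex n; lra.
Qed.

End Sequences.

(** * Monotonicity, shift and continuity of the Bellman operator *)

Section Bellman.
Context (R : realType) (S A : finType) (M : mdp R S A).
Implicit Types (pi : S -> A -> R) (U V : S -> R).

Lemma bellmanE pi V s : bellman M pi V s = \sum_a pi s a * qvalue M V s a.
Proof.
apply: eq_bigr => a _; congr (_ * _); rewrite /qvalue.
under eq_bigr do rewrite mulrDr.
rewrite big_split /= -mulr_suml (trans_dist M s a).2 mul1r mulr_sumr.
by congr (_ + _); apply: eq_bigr => s' _; rewrite mulrCA.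
Qed.

Lemma qvalueB U V s a : qvalue M U s a - qvalue M V s a =
  discount M * \sum_s' trans M s a s' * (U s' - V s').
Proof.
rewrite /qvalue opprD addrACA subrr add0r -mulrBr -sumrB.
by congr (_ * _); apply: eq_bigr => s' _; rewrite mulrBr.
Qed.

Lemma discount_ge0 : 0 <= discount M.
Proof. by case/andP: (discount_itv M). Qed.

Lemma discount_lt1 : discount M < 1.
Proof. by case/andP: (discount_itv M). Qed.

Lemma qvalue_le U V s a : (forall s', U s' <= V s') ->
  qvalue M U s a <= qvalue M V s a.
Proof.
move=> UV; rewrite -subr_ge0 qvalueB mulr_ge0 ?discount_ge0 //.
rewrite sumr_ge0 // => s' _.
by rewrite mulr_ge0 ?subr_ge0 ?(trans_dist M s a).1.
Qed.

Lemma bellman_le pi U V s : is_policy pi -> (forall s', U s' <= V s') ->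
  bellman M pi U s <= bellman M pi V s.
Proof.
move=> hpi UV; rewrite !bellmanE; apply: ler_sum => a _.
by rewrite ler_wpM2l ?qvalue_le // (hpi s).1.
Qed.

Lemma qvalue_shift V c s a :
  qvalue M (fun s' => V s' - c) s a = qvalue M V s a - discount M * c.
Proof.
have := qvalueB (fun s' => V s' - c) V s a.
rewrite (eq_bigr (fun s' => - (trans M s a s' * c))); last first.
  by move=> s' _; rewrite addrAC subrr add0r mulrN.
rewrite sumrN -mulr_suml (trans_dist M s a).2 mul1r; lra.
Qed.

Lemma bellman_shift pi V c s : is_policy pi ->
  bellman M pi (fun s' => V s' - c) s = bellman M pi V s - discount M * c.
Proof.
move=> hpi; rewrite !bellmanE (eq_bigr (fun a =>
  pi s a * qvalue M V s a - pi s a * (discount M * c))).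
  by rewrite sumrB -mulr_suml (hpi s).2 mul1r.
by move=> a _; rewrite qvalue_shift mulrBr.
Qed.

Lemma cvg_qvalue (V : nat -> S -> R) (W : S -> R) s a :
  (forall s', V n s' @[n --> \oo] --> W s') ->
  qvalue M (V n) s a @[n --> \oo] --> qvalue M W s a.
Proof.
move=> VW; apply: cvgD; first exact: cvg_cst.
apply: cvgM; first exact: cvg_cst.
by apply: cvg_sumr => s'; apply: cvgM; [exact: cvg_cst|exact: VW].
Qed.

End Bellman.

(** * The multiplicative-weights policy update *)

Section NpgUpdate.
Context (R : realType) (S A : finType) (eta : R).
Implicit Types (pi Q : S -> A -> R).

(** The factor exp(-eta c(s)) is common to all actions and cancels in the normalisation. Used both
    to shift V^0 and to centre the weights at the limit value. *)
Lemma npg_update_shift pi Q (c : S -> R) :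
  npg_update eta (fun s a => Q s a - c s) pi = npg_update eta Q pi.
Proof.
apply/funext => s; apply/funext => a; rewrite /npg_update.
under eq_bigr do rewrite mulrBr expRD mulrA.
rewrite mulrBr expRD mulrA -mulr_suml -mulf_div divff ?mulr1 //.
by rewrite gt_eqF ?expR_gt0.
Qed.

Context (hA : (0 < #|A|)%N).

Lemma sumr_gt0_fin (f : A -> R) : (forall a, 0 < f a) -> 0 < \sum_a f a.
Proof.
have [a0 _] := card_gt0P hA => f0; rewrite (bigD1 a0) //=.
by rewrite ltr_pwDl // sumr_ge0 // => a _; rewrite ltW.
Qed.

Lemma npg_update_gt0 pi Q : (forall s a, 0 < pi s a) ->
  forall s a, 0 < npg_update eta Q pi s a.
Proof.
move=> pi0 s a; rewrite divr_gt0 ?mulr_gt0 ?expR_gt0 // sumr_gt0_fin // => b.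
by rewrite mulr_gt0 ?expR_gt0.
Qed.

Lemma npg_update_policy pi Q : (forall s a, 0 < pi s a) ->
  is_policy (npg_update eta Q pi).
Proof.
move=> pi0 s; split=> [a|]; first by rewrite ltW // npg_update_gt0.
rewrite -mulr_suml divff // gt_eqF // sumr_gt0_fin // => b.
by rewrite mulr_gt0 ?expR_gt0.
Qed.

(* With m the mean of Q, e^(eta q) (q - m) >= e^(eta m) (q - m) for every q. *)
Lemma npg_update_improves pi Q s : 0 <= eta ->
  is_policy pi -> (forall s a, 0 < pi s a) ->
  \sum_a pi s a * Q s a <= \sum_a npg_update eta Q pi s a * Q s a.
Proof.
move=> eta0 hpi pi0; set m := leLHS.
under eq_bigr do rewrite /npg_update mulrAC.
rewrite -mulr_suml ler_pdivlMr; last first.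
  by apply: sumr_gt0_fin => b; rewrite mulr_gt0 ?expR_gt0.
rewrite mulr_sumr -subr_ge0 -sumrB.
(* The middle sum is zero because [m] is the mean of [Q s] under [pi s]. *)
apply: (@le_trans _ _ (\sum_a expR (eta * m) * (pi s a * (Q s a - m)))).
  rewrite -mulr_sumr (eq_bigr (fun a => pi s a * Q s a - pi s a * m)); last first.
    by move=> a _; rewrite mulrBr.
  by rewrite sumrB -mulr_suml (hpi s).2 mul1r subrr mulr0.
apply: ler_sum => a _.
rewrite -subr_ge0 (_ : _ - _ =
  pi s a * ((Q s a - m) * (expR (eta * Q s a) - expR (eta * m)))); last by ring.
apply: mulr_ge0; first exact: ltW.
have [mQ|Qm] := leP m (Q s a).
  by rewrite mulr_ge0 ?subr_ge0 ?ler_expR ?ler_wpM2l.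
by rewrite mulr_le0 ?subr_le0 ?ler_expR ?ler_wpM2l // ltW.
Qed.

End NpgUpdate.

(** * Positivity and boundedness of the iterates *)

Section TdNpg.
Context (R : realType) (S A : finType) (M : mdp R S A) (eta : R).
Context (hA : (0 < #|A|)%N) (eta_gt0 : 0 < eta).
Context (pi0 : S -> A -> R) (V0 : S -> R).
Context (pi0_policy : is_policy pi0) (pi0_gt0 : forall s a, 0 < pi0 s a).

Local Notation policy k := (td_npg M eta pi0 V0 k).1.
Local Notation val k := (td_npg M eta pi0 V0 k).2.
Local Notation Q k := (qvalue M (val k)).

Lemma td_npg_policyS k : policy k.+1 = npg_update eta (Q k) (policy k).
Proof. by rewrite /=; case: td_npg. Qed.

Lemma td_npg_valE k : val k.+1 = bellman M (policy k.+1) (val k).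
Proof. by rewrite /=; case: td_npg. Qed.

Lemma td_npg_gt0 k s a : 0 < policy k s a.
Proof.
elim: k s a => [//|k IH] s a.
by rewrite td_npg_policyS; exact: npg_update_gt0.
Qed.

Lemma td_npg_policy k : is_policy (policy k).
Proof.
case: k => [//|k]; rewrite td_npg_policyS; apply: npg_update_policy => //.
exact: td_npg_gt0.
Qed.

Lemma td_npg_ge0 k s a : 0 <= policy k s a.
Proof. exact/ltW/td_npg_gt0. Qed.

Lemma td_npg_le1 k s a : policy k s a <= 1.
Proof.
rewrite -(td_npg_policy k s).2 (bigD1 a) //= lerDl sumr_ge0 // => b _.
exact: td_npg_ge0.
Qed.

Lemma td_npg_val_bounded k s :
  val k s <= \sum_s' `|V0 s'| + (1 - discount M)^-1.
Proof.
have g1 : 0 < 1 - discount M by rewrite subr_gt0 discount_lt1.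
elim: k s => [|k IH] s.
  apply: (@le_trans _ _ `|V0 s|); first exact: ler_norm.
  rewrite (bigD1 s) //= -addrA lerDl addr_ge0 ?sumr_ge0 // invr_ge0 ltW //.
set B := _ + _ in IH *.
(* Equivalently 1 + gamma B <= B, so a Bellman step with rewards at most 1 preserves the bound
   [B]. *)
have B1 : 1 <= B * (1 - discount M).
  by rewrite -ler_pdivrMr // div1r lerDr sumr_ge0.
rewrite td_npg_valE bellmanE; apply: ler_wsum => [|a].
  exact: td_npg_policy.
have H : \sum_s' trans M s a s' * val k s' <= B.
  by apply: ler_wsum => [|//]; exact: trans_dist.
have /andP[_ r1] := reward_itv M s a.
have := ler_wpM2l (discount_ge0 M) H; rewrite /qvalue; lra.
Qed.

(** * Monotone convergence of the value estimates *)

Context (V0_le : forall s, V0 s <= bellman M pi0 V0 s).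

(** The next value is the mean of Q^k under the updated policy, and the update does not lower that
    mean. *)
Lemma td_npg_val_leS k :
  (forall s, val k s <= bellman M (policy k) (val k) s) ->
  forall s, val k s <= val k.+1 s.
Proof.
move=> H s; apply: (le_trans (H s)); rewrite td_npg_valE !bellmanE.
rewrite td_npg_policyS; apply: npg_update_improves => //; first exact: ltW.
  exact: td_npg_policy.
exact: td_npg_gt0.
Qed.

(** The invariant propagates because V^{k+1} = T V^k <= T V^{k+1}, with T the monotone operator of
    the new policy. *)
Lemma td_npg_val_le_bellman k s : val k s <= bellman M (policy k) (val k) s.
Proof.
elim: k s => [//|k IH] s; rewrite {1}td_npg_valE.
by apply: bellman_le; [exact: td_npg_policy|exact: td_npg_val_leS].
Qed.

Lemma td_npg_val_nondecreasing s : nondecreasing_seq (fun k => val k s).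
Proof.
by apply/nondecreasing_seqP => k; apply: td_npg_val_leS => s';
  exact: td_npg_val_le_bellman.
Qed.

Lemma td_npg_val_is_cvg s : cvgn (fun k => val k s).
Proof.
apply: nondecreasing_is_cvgn; first exact: td_npg_val_nondecreasing.
by eexists => _ [k _ <-]; exact: td_npg_val_bounded.
Qed.

Definition val_lim (s : S) : R := limn (fun k => val k s).
Local Notation q := (qvalue M val_lim).

Lemma td_npg_val_cvg s : val k s @[k --> \oo] --> val_lim s.
Proof. exact: td_npg_val_is_cvg. Qed.

Lemma td_npg_val_le_lim k s : val k s <= val_lim s.
Proof.
apply: (nondecreasing_cvgn_le (u_ := fun k => val k s)).
  exact: td_npg_val_nondecreasing.
exact: td_npg_val_is_cvg.
Qed.

Lemma td_npg_q_le_lim k s a : Q k s a <= q s a.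
Proof. by apply: qvalue_le => s'; exact: td_npg_val_le_lim. Qed.

Lemma td_npg_q_cvg s a : Q k s a @[k --> \oo] --> q s a.
Proof.
exact: (@cvg_qvalue _ _ _ M (fun k => val k) val_lim _ _ td_npg_val_cvg).
Qed.

(** * Summable errors and convergence of the policies *)

Section Greedy.
Context (best : S -> A) (bestP : forall s a, q s a <= q s (best s)).

(** The ratio of the masses of [a] and [best s] is multiplied at each step by exp(eta (Q^k(s,a) -
    Q^k(s,b))), without normaliser, and it dominates the mass of [a] since the other mass is at most
    1. *)
Lemma suboptimal_bounded s a : q s a < q s (best s) ->
  exists C, forall n, series (fun k => policy k s a) n <= C.
Proof.
set b := best s => ab; set u := fun k => policy k s a / policy k s b.
(* Half the gap: Q^k(s,a) never exceeds its limit, so once Q^k(s,b) is within [d] of its own limit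
   the difference is at most -d. *)
pose d := (q s b - q s a) / 2; have d0 : 0 < d by rewrite divr_gt0 ?subr_gt0.
have u0 k : 0 <= u k by rewrite divr_ge0 ?td_npg_ge0.
have uS k : u k.+1 = expR (eta * (Q k s a - Q k s b)) * u k.
  rewrite /u td_npg_policyS /npg_update; set Z := \sum_b _.
  have Z0 : Z != 0.
    rewrite gt_eqF // sumr_gt0_fin // => c.
    by rewrite mulr_gt0 ?expR_gt0 ?td_npg_gt0.
  rewrite mulrBr expRB; field.
  by rewrite Z0 !gt_eqF ?expR_gt0 ?td_npg_gt0.
have [C uC] : exists C, forall n, series u n <= C.
  apply: (@eventually_geometric_bounded _ u (expR (eta * - d))) => //.
    by rewrite -expR0 ltr_expR pmulr_rlt0 // oppr_lt0.
  have bd : q s b - d < q s b by rewrite ltrBlDr ltrDl.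
  near=> k; rewrite uS ler_wpM2r // ler_expR ler_wpM2l ?(ltW eta_gt0) //.
  have Qb : q s b - d < Q k s b.
    by near: k; apply: cvgr_gt bd; exact: td_npg_q_cvg.
  have := td_npg_q_le_lim k s a; rewrite /d in Qb *; lra.
exists C => n; apply: le_trans (uC n); apply: ler_sum => k _.
by rewrite ler_pdivlMr ?td_npg_gt0 // ler_piMr ?td_npg_ge0 ?td_npg_le1.
Unshelve. all: by end_near. Qed.

(** The index k+1 matches the policy that produces V^{k+1} from V^k. *)
Definition regret k s := \sum_a policy k.+1 s a * (q s (best s) - q s a).

Lemma regret_ge0 k s : 0 <= regret k s.
Proof.
by apply: sumr_ge0 => a _; rewrite mulr_ge0 ?td_npg_ge0 // subr_ge0.
Qed.

Lemma regret_bounded s :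
  exists C, forall n, series (fun k => regret k s) n <= C.
Proof.
have /choice[C hC] a : exists C, forall n,
    series (fun k => policy k.+1 s a * (q s (best s) - q s a)) n <= C.
  (* Actions tied with [best s] contribute nothing, however much mass they keep. *)
  have := bestP s a; rewrite le_eqVlt => /predU1P[<-|ab].
    by exists 0 => n; rewrite /series /= big1 // => k _; rewrite subrr mulr0.
  have [C hC] := suboptimal_bounded ab.
  exists (C * (q s (best s) - q s a)) => n.
  rewrite /series /= -mulr_suml ler_wpM2r ?subr_ge0 ?(ltW ab) //.
  (* The shifted sum over policies 1 to n is completed by the nonnegative term of index 0. *)
  apply: le_trans (hC n.+1); rewrite /series /= big_nat_recl // lerDr.
  exact: td_npg_ge0.
exists (\sum_a C a) => n; rewrite /series /= exchange_big.
by apply: ler_sum => a _; have := hC a n; rewrite /series /=.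
Qed.

(** Inserting the mean of [q] under the new policy separates the estimation error of Q^k from the
    regret; both the limit equation and the error recursion start from this split. *)
Lemma best_subE k s : q s (best s) - val k.+1 s =
  \sum_a policy k.+1 s a * (q s a - Q k s a) + regret k s.
Proof.
rewrite td_npg_valE bellmanE -big_split /=.
rewrite -[X in X - _]mul1r -(td_npg_policy k.+1 s).2 mulr_suml -sumrB.
by apply: eq_bigr => a _; ring.
Qed.

Lemma val_lim_best s : val_lim s = q s (best s).
Proof.
have lim1 : val k.+1 s @[k --> \oo] --> val_lim s.
  by have := td_npg_val_cvg (s := s); rewrite -cvg_shiftS.
apply: (cvg_unique _ lim1) => //.
(* Bounding the policy weights by 1 makes the limit of [err] independent of the policies, whose
   convergence is not yet known. *)
pose err k := \sum_a (q s a - Q k s a) + regret k s.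
have err0 : err k @[k --> \oo] --> 0.
  rewrite -[0]addr0; apply: cvgD.
    rewrite -[X in _ --> X](_ : \sum_(a : A) 0 = 0); last by rewrite big1.
    apply: cvg_sumr => a; rewrite -[X in _ --> X](subrr (q s a)).
    by apply: cvgB; [exact: cvg_cst|exact: td_npg_q_cvg].
  have [C hC] := regret_bounded s.
  apply: cvg_series_cvg_0; apply: summable_bounded hC => k; exact: regret_ge0.
apply: (@squeeze_cvgr _ _ _ _ (fun k => q s (best s) - err k)
  (fun _ => q s (best s))).
- near=> k; apply/andP; split.
    rewrite lerBlDr addrC -lerBlDr best_subE lerD2r; apply: ler_sum => a _.
    by rewrite ler_piMl ?td_npg_le1 // subr_ge0 td_npg_q_le_lim.
  rewrite -subr_ge0 best_subE addr_ge0 ?regret_ge0 ?sumr_ge0 // => a _.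
  by rewrite mulr_ge0 ?td_npg_ge0 // subr_ge0 td_npg_q_le_lim.
- rewrite -[X in _ --> X]subr0; apply: cvgB err0; exact: cvg_cst.
- exact: cvg_cst.
Unshelve. all: by end_near. Qed.

(** The default 0 is harmless because all the differences are nonnegative. *)
Definition val_err k := \big[Num.max/0]_s (val_lim s - val k s).

Lemma val_err_ge0 k : 0 <= val_err k.
Proof. by rewrite /val_err; elim/big_ind: _ => // [x y x0 y0|s _];
  [rewrite le_max x0|rewrite subr_ge0 td_npg_val_le_lim]. Qed.

Lemma q_err_le k s a : q s a - Q k s a <= discount M * val_err k.
Proof.
rewrite qvalueB ler_wpM2l ?discount_ge0 //; apply: ler_wsum => [|s'].
  exact: trans_dist.
exact: (le_bigmax 0 (fun s => val_lim s - val k s)).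
Qed.

(** In [best_subE] the averaged Q-error contracts by gamma; the regret at one state is bounded by
    the sum over states. *)
Lemma val_err_recursion k :
  val_err k.+1 <= discount M * val_err k + \sum_s regret k s.
Proof.
have r0 : 0 <= \sum_s regret k s by apply: sumr_ge0 => s _; exact: regret_ge0.
apply: bigmax_le => [|s _].
  by rewrite addr_ge0 // mulr_ge0 ?discount_ge0 ?val_err_ge0.
rewrite val_lim_best best_subE lerD //.
  by apply: ler_wsum => [|a]; [exact: td_npg_policy|exact: q_err_le].
by rewrite (bigD1 s) //= lerDl sumr_ge0 // => s' _; exact: regret_ge0.
Qed.

(** [contraction_bounded] turns summable regrets into summable value errors, which dominate the
    Q-errors. *)
Lemma q_err_bounded :
  exists C, forall s a n, series (fun k => q s a - Q k s a) n <= C.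
Proof.
have /choice[D hD] := regret_bounded.
have rD n : series (fun k => \sum_s regret k s) n <= \sum_s D s.
  rewrite /series /= exchange_big; apply: ler_sum => s _.
  by have := hD s n; rewrite /series /=.
have [C hC] := contraction_bounded (discount_lt1 M) val_err_ge0
  val_err_recursion rD.
exists C => s a n; apply: le_trans (hC n); apply: ler_sum => k _.
apply: le_trans (q_err_le k s a) _; apply: ler_piMl; first exact: val_err_ge0.
exact/ltW/discount_lt1.
Qed.

(* Unnormalised policy; centring at [val_lim] makes it nonincreasing in [k]. *)
Definition weight k s a :=
  pi0 s a * expR (eta * series (fun i => Q i s a - val_lim s) k).

Lemma weight_gt0 k s a : 0 < weight k s a.
Proof. by rewrite mulr_gt0 ?expR_gt0. Qed.

(** Earlier normalisers cancel, and centring each Q^k at [val_lim] is invisible by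
    [npg_update_shift]. *)
Lemma td_npg_weight k s a :
  policy k s a = weight k s a / \sum_b weight k s b.
Proof.
have weight0 s' b : weight 0 s' b = pi0 s' b.
  by rewrite /weight /series /= big_geq // mulr0 expR0 mulr1.
elim: k s a => [|k IH] s a.
  under eq_bigr do rewrite weight0.
  by rewrite weight0 (pi0_policy s).2 divr1.
rewrite td_npg_policyS -(npg_update_shift _ _ _ val_lim) /npg_update /=.
have weightS b : policy k s b * expR (eta * (Q k s b - val_lim s)) =
    weight k.+1 s b / \sum_c weight k s c.
  rewrite IH mulrAC; congr (_ / _).
  by rewrite /weight seriesSr [in RHS]mulrDr expRD mulrA.
rewrite weightS; under eq_bigr => b _ do rewrite weightS.
rewrite -mulr_suml -mulf_div divff ?mulr1 // invr_eq0 gt_eqF //.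
by apply: sumr_gt0_fin => // b; exact: weight_gt0.
Qed.

(** Each added exponent is nonpositive, as Q^k(s,a) <= q(s,a) <= q(s, best s) = [val_lim s]. *)
Lemma weight_is_cvg s a : cvgn (fun k => weight k s a).
Proof.
apply: nonincreasing_is_cvgn.
  apply/nonincreasing_seqP => k; rewrite ler_pM2l // ler_expR.
  rewrite ler_wpM2l ?(ltW eta_gt0) // seriesSr gerDl subr_le0 val_lim_best.
  exact: le_trans (td_npg_q_le_lim k s a) (bestP s a).
by exists 0 => _ [k _ <-]; rewrite ltW // weight_gt0.
Qed.

(** For [best s] the exponent is minus eta times a bounded error sum, so its weight stays above a
    positive constant. The limit can then be taken in the normalised quotient. *)
Lemma weight_lim_gt0 s : 0 < \sum_a limn (fun k => weight k s a).
Proof.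
have [C hC] := q_err_bounded.
rewrite (bigD1 (best s)) //= ltr_pwDl //; last first.
  apply: sumr_ge0 => a _; apply: limr_ge; first exact: weight_is_cvg.
  by near=> k; rewrite ltW // weight_gt0.
apply: (@lt_le_trans _ _ (pi0 s (best s) * expR (eta * - C))).
  by rewrite mulr_gt0 ?expR_gt0.
apply: limr_ge; first exact: weight_is_cvg.
near=> k; rewrite ler_pM2l // ler_expR ler_wpM2l ?(ltW eta_gt0) // lerNl.
apply: le_trans (hC s (best s) k); rewrite /series /= -sumrN.
by apply: ler_sum => i _; rewrite opprB -val_lim_best.
Unshelve. all: by end_near. Qed.

Lemma td_npg_cvg_greedy : exists pistar : S -> A -> R,
  [/\ is_policy pistar,
      forall s a, policy k s a @[k --> \oo] --> pistar s a,
      forall s, bellman M pistar val_lim s = val_lim s &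
      forall pi s, is_policy pi -> bellman M pi val_lim s <= val_lim s].
Proof.
pose w s a := limn (fun k => weight k s a).
pose pistar s a := w s a / \sum_b w s b.
have cv s a : policy k s a @[k --> \oo] --> pistar s a.
  under eq_fun do rewrite td_npg_weight.
  apply: cvgM; first exact: weight_is_cvg.
  apply: cvgV; first by rewrite gt_eqF // weight_lim_gt0.
  by apply: cvg_sumr => b; exact: weight_is_cvg.
exists pistar; split=> //.
- move=> s; split=> [a|]; last first.
    by rewrite -mulr_suml divff // gt_eqF // weight_lim_gt0.
  rewrite -(cvg_lim (@norm_hausdorff _ _) (cv s a)).
  apply: limr_ge; first by apply/cvg_ex; eexists; exact: cv.
  by near=> k; exact: td_npg_ge0.
(* The fixed-point equation is the limit of V^{k+1} = T V^k, with T taken for the policy of index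
   k+1. *)
- move=> s; rewrite bellmanE.
  have lim1 : val k.+1 s @[k --> \oo] --> val_lim s.
    by have := td_npg_val_cvg (s := s); rewrite -cvg_shiftS.
  apply: (cvg_unique _ _ lim1) => //.
  have -> : (fun k => val k.+1 s) = (fun k => \sum_a policy k.+1 s a * Q k s a).
    by apply/funext => k; rewrite td_npg_valE bellmanE.
  apply: cvg_sumr => a; apply: cvgM; last exact: td_npg_q_cvg.
  by have := cv s a; rewrite -cvg_shiftS.
- move=> pi s hpi; rewrite bellmanE val_lim_best.
  by apply: ler_wsum.
Unshelve. all: by end_near. Qed.

End Greedy.

Lemma best_exists : exists best : S -> A, forall s a, q s a <= q s (best s).
Proof.
have [a0 _] := card_gt0P hA.
exists (fun s => [arg max_(a > a0) q s a]%O) => s a.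
by case: arg_maxP => // b _; apply.
Qed.

End TdNpg.

(** * Discounted returns along a trajectory *)

Lemma measure_partition d (T : measurableType d) (R : realType)
    (P : {measure set T -> \bar R}) (I : finType) (F : T -> I) (E : set T) :
  (forall i, measurable [set w | F w = i]) -> measurable E ->
  P E = (\sum_i P (E `&` [set w | F w = i]))%E.
Proof.
move=> mF mE.
have -> : P E = P (\bigcup_(i in [set: I]) (E `&` [set w | F w = i])).
  by congr (P _); apply/seteqP; split=> [w Ew|w [i _ []]//]; exists (F w).
rewrite measure_fin_bigcup //; first last.
- by move=> i _; exact: measurableI.
- by move=> i j _ _ [w [[_ <-] [_ <-]]].
- exact: finite_finset.
rewrite (@fsbigE _ _ _ _ _ (index_enum I)) ?index_enum_uniq //.
  by apply: eq_bigl => i; rewrite in_setT.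
by move=> i _; rewrite mem_index_enum.
Qed.

(** * The law of the state-action pair at each time *)

Section Trajectory.
Context (R : realType) (S A : finType) (M : mdp R S A).
Context (pi : S -> A -> R) (pi_policy : is_policy pi) (s : S).
Context (X : rollout M pi s).

Local Notation P := (rollout_prob X).
Local Notation T := (sample_space X).

Definition visits n (z : S * A) : set T :=
  [set w | (state_at X n w, action_at X n w) = z].

Lemma measurable_visits n z : measurable (visits n z).
Proof.
have -> : visits n z =
    [set w | state_at X n w = z.1] `&` [set w | action_at X n w = z.2].
  by apply/seteqP; case: z => x a; split=> w /=; rewrite /visits /= => -[-> ->].
by apply: measurableI; [exact: measurable_state_at|exact: measurable_action_at].
Qed.

Definition cylinder n (x : nat -> S) (a : nat -> A) : set T :=
  [set w | forall t, (t <= n)%N ->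
           state_at X t w = x t /\ action_at X t w = a t].

Lemma measurable_cylinder n x a : measurable (cylinder n x a).
Proof.
have -> : cylinder n x a =
    \bigcap_(t in [set t | (t <= n)%N]) visits t (x t, a t).
  by apply/seteqP; split=> w Hw t /Hw; rewrite /visits /= => -[-> ->].
by apply: bigcap_measurableType => t _; exact: measurable_visits.
Qed.

Lemma cylinder_lawS n x a : P (cylinder n.+1 x a) = (P (cylinder n x a) *
  (trans M (x n) (a n) (x n.+1) * pi (x n.+1) (a n.+1))%:E)%E.
Proof.
rewrite /cylinder !rollout_law // -EFinM big_ord_recr /=.
rewrite [X in _ * X]big_ord_recr /=; congr EFin; ring.
Qed.

(** A finite function, so that histories range over a finite type and [measure_partition]
    applies. *)
Definition prefix_of n (w : T) : {ffun 'I_n.+1 -> S * A} :=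
  [ffun t : 'I_n.+1 => (state_at X t w, action_at X t w)].

Lemma prefix_of_cylinder n (f : {ffun 'I_n.+1 -> S * A}) :
  [set w | prefix_of n w = f] =
  cylinder n (fun t => (f (inord t)).1) (fun t => (f (inord t)).2).
Proof.
apply/seteqP; split=> w /= => [<- t tn|H].
  by rewrite /prefix_of ffunE inordK.
apply/ffunP => t; rewrite ffunE; have [] := H t (leq_ord t).
by rewrite inord_val => -> ->; rewrite -surjective_pairing.
Qed.

(** Markov property. The rollout law concerns full histories, so the event is partitioned by
    history; on each one the factor for the next pair depends only on the last pair. *)
Lemma visits_recursion n z : P (visits n.+1 z) =
  (\sum_y P (visits n y) * (trans M y.1 y.2 z.1 * pi z.1 z.2)%:E)%E.
Proof.
pose K (y : S * A) := trans M y.1 y.2 z.1 * pi z.1 z.2.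
have mF f : measurable [set w | prefix_of n w = f].
  by rewrite prefix_of_cylinder; exact: measurable_cylinder.
rewrite (measure_partition P mF) //; last exact: measurable_visits.
transitivity (\sum_(f : {ffun 'I_n.+1 -> S * A})
    \sum_y P (visits n y `&` [set w | prefix_of n w = f]) * (K y)%:E)%E; last first.
  rewrite exchange_big; apply: eq_bigr => y _.
  rewrite (measure_partition P mF) ?ge0_sume_distrl //.
  exact: measurable_visits.
(* A fixed history determines the pair at time n, so only y = [f ord_max] contributes. *)
apply: eq_bigr => f _; rewrite (bigD1 (f ord_max)) //= [X in (_ + X)%E]big1.
  rewrite adde0 [visits n _ `&` _]setIidr; last first.
    by move=> w /= <-; rewrite /visits /= /prefix_of ffunE.
  (* The history [f] is continued by [z] at time n+1. *)
  pose x t := if (t <= n)%N then (f (inord t)).1 else z.1.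
  pose a t := if (t <= n)%N then (f (inord t)).2 else z.2.
  have fn : f (inord n) = f ord_max.
    by congr (f _); apply/val_inj; rewrite /= inordK.
  have -> : [set w | prefix_of n w = f] = cylinder n x a.
    rewrite prefix_of_cylinder; apply/seteqP.
    by split=> w H t tn; have := H t tn; rewrite /x /a tn.
  have -> : visits n.+1 z `&` cylinder n x a = cylinder n.+1 x a.
    apply/seteqP; split=> w.
      move=> [zE H] t; rewrite leq_eqVlt => /predU1P[->|]; last exact: H.
      by rewrite /x /a ltnn; move: zE; rewrite /visits /= => <-.
    move=> H; split; last by move=> t tn; apply: H; exact: leqW.
    have [] := H n.+1 (leqnn _); rewrite /x /a ltnn /visits /= => -> ->.
    by rewrite -surjective_pairing.
  by rewrite cylinder_lawS /x /a leqnn ltnn fn.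
move=> y yf; rewrite [X in P X](_ : _ = set0) ?measure0 ?mul0e //.
apply/seteqP; split=> w //= -[]; rewrite /visits /= => zE fE.
by move: yf; rewrite -zE -fE /prefix_of ffunE eqxx.
Qed.

(** Real-valued forward recursion for the law of the state at time n; [visits_law] ties it to the
    rollout. *)
Fixpoint state_law n : S -> R :=
  if n is n'.+1 then
    fun y => \sum_x state_law n' x * \sum_a pi x a * trans M x a y
  else fun y => (y == s)%:R.

Lemma state_law_dist n : is_dist (state_law n).
Proof.
elim: n => [|n [IH0 IH1]]; split=> /=.
- by move=> y; rewrite ler0n.
- by rewrite (bigD1 s) //= eqxx big1 ?addr0 // => y /negbTE ->.
- move=> y; apply: sumr_ge0 => x _; rewrite mulr_ge0 // sumr_ge0 // => a _.
  by rewrite mulr_ge0 ?(pi_policy x).1 ?(trans_dist M x a).1.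
rewrite exchange_big -[RHS]IH1; apply: eq_bigr => x _.
rewrite -mulr_sumr exchange_big /= (eq_bigr (pi x)).
  by rewrite (pi_policy x).2 mulr1.
by move=> a _; rewrite -mulr_sumr (trans_dist M x a).2 mulr1.
Qed.

Lemma visits_law n y b :
  P (visits n (y, b)) = (state_law n y * pi y b)%:E.
Proof.
elim: n y b => [|n IH] y b.
  have -> : visits 0 (y, b) = cylinder 0 (fun=> y) (fun=> b).
    apply/seteqP; split=> w; rewrite /visits /cylinder /=.
      by move=> [<- <-] t; rewrite leqn0 => /eqP ->.
    by move=> /(_ 0%N isT)[-> ->].
  by rewrite /cylinder rollout_law // big_ord1 big_ord0 mulr1.
rewrite visits_recursion /= (eq_bigr (fun z =>
    (state_law n z.1 * (pi z.1 z.2 * trans M z.1 z.2 y) * pi y b)%:E)).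
  rewrite sumEFin -mulr_suml; congr (_ * _)%:E.
  rewrite -(pair_big xpredT xpredT (fun x a =>
    state_law n x * (pi x a * trans M x a y))) /=.
  by apply: eq_bigr => x _; rewrite mulr_sumr.
by move=> [x a] _; rewrite IH -EFinM; congr EFin => /=; ring.
Qed.

Section Step.
Context (h : S -> A -> R) (n : nat).
Local Notation hn := (fun w => h (state_at X n w) (action_at X n w)).

(** As a simple function, the step reward inherits its measurability and integral from [visits]. *)
Lemma step_indicE : hn = (fun w => \sum_z h z.1 z.2 * \1_(visits n z) w).
Proof.
apply/funext => w; rewrite (bigD1 (state_at X n w, action_at X n w)) //=.
rewrite big1 ?addr0; first by rewrite indicE mem_set // mulr1.
by move=> z zw; rewrite indicE memNset ?mulr0 // => e; rewrite -e eqxx in zw.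
Qed.

Lemma measurable_step : measurable_fun setT hn.
Proof.
rewrite step_indicE; apply: measurable_sum => z; apply: measurable_funM => //.
by apply: measurable_indic; exact: measurable_visits.
Qed.

Lemma integrable_step : P.-integrable setT (EFin \o hn).
Proof.
apply: measurable_bounded_integrable => //.
- exact: le_lt_trans (probability_le1 P measurableT) (ltry 1).
- exact: measurable_step.
exists (\sum_z `|h z.1 z.2|); split; first by rewrite num_real.
move=> c Hc w _; apply: le_trans (ltW Hc).
by rewrite (bigD1 (state_at X n w, action_at X n w)) //= lerDl sumr_ge0.
Qed.

Lemma integral_step : (\int[P]_w (hn w)%:E =
  (\sum_y state_law n y * \sum_b pi y b * h y b)%:E)%E.
Proof.
rewrite step_indicE.
under eq_integral do rewrite -sumEFin.
rewrite integral_sum //; last first.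
  move=> z; under eq_fun do rewrite EFinM.
  by apply: integrableZl => //; apply: integrable_indic; exact: measurable_visits.
rewrite (eq_bigr (fun z => (state_law n z.1 * (pi z.1 z.2 * h z.1 z.2))%:E)).
  rewrite sumEFin; congr EFin.
  rewrite -(pair_big xpredT xpredT (fun x a =>
    state_law n x * (pi x a * h x a))) /=.
  by apply: eq_bigr => x _; rewrite mulr_sumr.
move=> [y b] _ /=; under eq_integral do rewrite EFinM.
rewrite integralZl //; last by apply: integrable_indic; exact: measurable_visits.
rewrite integral_indic // ?setIT; last exact: measurable_visits.
transitivity ((h y b)%:E * P (visits n (y, b)))%E; first by [].
by rewrite visits_law -EFinM; congr EFin; ring.
Qed.

End Step.

(** * Expected discounted return as a limit of finite-horizon means *)

Definition partial_return n (w : T) : R := series (fun t =>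
  discount M ^+ t * reward M (state_at X t w) (action_at X t w)) n.

(** Comparison with the geometric series shows that the [limn] in [discounted_return] is a genuine
    limit. *)
Lemma partial_return_cvg w :
  partial_return n w @[n --> \oo] --> discounted_return w.
Proof.
have g0 := discount_ge0 M; have g1 := discount_lt1 M.
apply: (series_le_cvg (v_ := geometric 1 (discount M))).
- move=> n; have /andP[r0 _] := reward_itv M (state_at X n w) (action_at X n w).
  by rewrite mulr_ge0 // exprn_ge0.
- by move=> n; rewrite /geometric /= mul1r exprn_ge0.
- move=> n; rewrite /geometric /= mul1r ler_piMr ?exprn_ge0 //.
  by have /andP[] := reward_itv M (state_at X n w) (action_at X n w).
by apply: is_cvg_geometric_series; rewrite ger0_norm.
Qed.

Lemma partial_return_bounds n w :
  0 <= partial_return n w <= (1 - discount M)^-1.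
Proof.
have g0 := discount_ge0 M; have g1 : 0 < 1 - discount M.
  by rewrite subr_gt0 discount_lt1.
have rw t := reward_itv M (state_at X t w) (action_at X t w).
apply/andP; split.
  by apply: sumr_ge0 => t _; have /andP[r0 _] := rw t;
    rewrite mulr_ge0 // exprn_ge0.
apply: (@le_trans _ _ (\sum_(0 <= t < n) discount M ^+ t)).
  apply: ler_sum => t _; rewrite ler_piMr ?exprn_ge0 //.
  by have /andP[] := rw t.
rewrite -[leRHS]div1r ler_pdivlMr // big_mkord.
have := subrX1 (discount M) n; have := exprn_ge0 n g0; lra.
Qed.

Definition mean_return n : R := series (fun t =>
  discount M ^+ t * \sum_y state_law t y * \sum_b pi y b * reward M y b) n.

Lemma integral_partial_return n :
  (\int[P]_w (partial_return n w)%:E = (mean_return n)%:E)%E.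
Proof.
rewrite /partial_return /mean_return /series /=.
under eq_integral do rewrite -sumEFin.
rewrite integral_sum //; last first.
  move=> t; under eq_fun do rewrite EFinM.
  by apply: integrableZl => //; exact: integrable_step.
rewrite -sumEFin; apply: eq_bigr => t _.
under eq_integral do rewrite EFinM.
by rewrite integralZl ?integral_step //; exact: integrable_step.
Qed.

(** Dominated convergence with the constant 1/(1 - gamma); integrability of the limit makes [fine]
    faithful. *)
Lemma mean_return_cvg : mean_return n @[n --> \oo] -->
  fine ('E_P[@discounted_return _ _ _ M pi s X])%E.
Proof.
have mpart n : measurable_fun setT (partial_return n).
  rewrite /partial_return /series /=; apply: measurable_sum => t.
  by apply: measurable_funM => //; exact: measurable_step.
have [|||||int_lim _ cvg_lim] := @dominated_convergence _ _ _ P setT measurableT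
  (fun n w => (partial_return n w)%:E)
  (fun w => (@discounted_return _ _ _ M pi s X w)%:E)
  (fun=> ((1 - discount M)^-1)%:E).
- by move=> n; exact/measurable_EFinP.
- apply/measurable_EFinP/(measurable_fun_cvg mpart) => w _.
  exact: partial_return_cvg.
- apply: aeW => w _; apply: cvg_EFin; first by near=> n.
  exact: partial_return_cvg.
- exact: (@finite_measure_integrable_cst _ _ _ P).
- apply: aeW => w n _; have /andP[p0 p1] := partial_return_bounds n w.
  by rewrite lee_fin ger0_norm.
rewrite unlock; apply: (@fine_cvg _ _ _ _ (fun n => (mean_return n)%:E)).
rewrite fineK; last exact: integrable_fin_num.
by move: cvg_lim; under eq_fun do rewrite integral_partial_return.
Unshelve. all: by end_near. Qed.

(** * Telescoping with the Bellman operator *)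

Lemma state_law_step V n : \sum_y state_law n y * bellman M pi V y =
  \sum_y state_law n y * \sum_b pi y b * reward M y b +
  discount M * \sum_y state_law n.+1 y * V y.
Proof.
have -> : \sum_y state_law n.+1 y * V y = \sum_x state_law n x *
    \sum_a pi x a * \sum_y trans M x a y * V y.
  under eq_bigr do rewrite /= mulr_suml.
  rewrite exchange_big; apply: eq_bigr => x _ /=.
  under eq_bigr do rewrite -mulrA.
  rewrite -mulr_sumr; congr (_ * _); under [LHS]eq_bigr do rewrite mulr_suml.
  rewrite exchange_big; apply: eq_bigr => a _ /=.
  by rewrite mulr_sumr; apply: eq_bigr => y _; rewrite mulrA.
rewrite mulr_sumr -big_split; apply: eq_bigr => x _ /=.
rewrite mulrCA -mulrDr bellmanE; congr (_ * _).
rewrite [in RHS]mulr_sumr -big_split /=.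
by apply: eq_bigr => a _; rewrite /qvalue mulrDr [X in _ + X]mulrCA.
Qed.

(** By [state_law_step] each mean reward is a Bellman term minus the next discounted mean of [V], so
    the means of [V] telescope. What remains is a series of Bellman residuals, zero or of known sign
    in the two uses below. *)
Lemma mean_return_bellman V n : mean_return n =
  V s - discount M ^+ n * (\sum_y state_law n y * V y) +
  series (fun t =>
    discount M ^+ t * \sum_y state_law t y * (bellman M pi V y - V y)) n.
Proof.
elim: n => [|n IH].
  rewrite /mean_return /series /= !big_geq // (bigD1 s) //= eqxx expr0 big1.
    by rewrite !mul1r !addr0 subrr.
  by move=> y /negbTE ->; rewrite mul0r.
rewrite [in RHS]seriesSr /mean_return seriesSr -/(mean_return n) IH.
have -> : \sum_y state_law n y * (bellman M pi V y - V y) =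
    \sum_y state_law n y * bellman M pi V y - \sum_y state_law n y * V y.
  by rewrite -sumrB; apply: eq_bigr => y _; rewrite mulrBr.
rewrite state_law_step exprSr; ring.
Qed.

(** The mean is bounded by the sum of |V| uniformly in n, and gamma^n tends to 0. *)
Lemma discounted_mean_cvg0 V :
  discount M ^+ n * (\sum_y state_law n y * V y) @[n --> \oo] --> 0.
Proof.
have g0 := discount_ge0 M.
have gB : discount M ^+ n * \sum_y `|V y| @[n --> \oo] --> 0.
  rewrite -[X in _ --> X](mul0r (\sum_y `|V y|)).
  apply: cvgM; last exact: cvg_cst.
  by apply: cvg_expr; rewrite ger0_norm // discount_lt1.
apply/norm_cvg0P; apply: (squeeze_cvgr _ (cvg_cst 0) gB); near=> n.
rewrite normr_ge0 normrM ger0_norm ?exprn_ge0 // ler_wpM2l ?exprn_ge0 //=.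
apply: le_trans (ler_norm_sum _ _ _) _; apply: ler_sum => y _.
have [d0 d1] := state_law_dist n.
rewrite normrM ger0_norm ?d0 // ler_piMl // -d1 (bigD1 y) //= lerDl.
by rewrite sumr_ge0.
Unshelve. all: by end_near. Qed.

Lemma mean_return_cvg_fix V : (forall y, bellman M pi V y = V y) ->
  mean_return n @[n --> \oo] --> V s.
Proof.
move=> fixV; rewrite -[X in _ --> X]subr0.
have -> : mean_return = fun n =>
    V s - discount M ^+ n * (\sum_y state_law n y * V y).
  apply/funext => n; rewrite (mean_return_bellman V) -[RHS]addr0; congr (_ + _).
  rewrite /series /= big1 // => t _; rewrite big1 ?mulr0 // => y _.
  by rewrite fixV subrr mulr0.
by apply: cvgB; [exact: cvg_cst|exact: discounted_mean_cvg0].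
Qed.

Lemma mean_return_lim_le V (l : R) : (forall y, bellman M pi V y <= V y) ->
  mean_return n @[n --> \oo] --> l -> l <= V s.
Proof.
move=> leV cl; have cV : V s - discount M ^+ n * (\sum_y state_law n y * V y)
    @[n --> \oo] --> V s.
  rewrite -[X in _ --> X]subr0; apply: cvgB; first exact: cvg_cst.
  exact: discounted_mean_cvg0.
apply: (ler_cvg_to cl cV); near=> n; rewrite (mean_return_bellman V) gerDl.
apply: sumr_le0 => t _; rewrite mulr_ge0_le0 ?exprn_ge0 ?discount_ge0 //.
apply: sumr_le0 => y _; rewrite mulr_ge0_le0 ?subr_le0 //.
by have [] := state_law_dist t.
Unshelve. all: by end_near. Qed.

End Trajectory.

(** * From Bellman relations to optimality *)

Section Value.
Context (R : realType) (S A : finType) (M : mdp R S A).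
Context (X : forall (pi : S -> A -> R) (s : S), rollout M pi s).

Lemma value_le pi V : is_policy pi -> (forall s, bellman M pi V s <= V s) ->
  forall s, value X pi s <= V s.
Proof.
by move=> hpi hV s; apply: (mean_return_lim_le hpi hV); exact: mean_return_cvg.
Qed.

Lemma value_fix pi V : is_policy pi -> (forall s, bellman M pi V s = V s) ->
  forall s, value X pi s = V s.
Proof.
move=> hpi hV s; have cX := mean_return_cvg hpi (X := X pi s).
apply: (cvg_unique _ cX) => //; exact: mean_return_cvg_fix.
Qed.

Lemma bellman_optimal pi V : is_policy pi ->
  (forall s, bellman M pi V s = V s) ->
  (forall pi' s, is_policy pi' -> bellman M pi' V s <= V s) -> optimal X pi.
Proof.
move=> hpi fixV maxV; split=> // s; apply/le_anti/andP.
(* This bound also certifies that the set is bounded above, which [sup] requires. *)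
have ub : ubound [set value X pi' s | pi' in @is_policy R S A] (value X pi s).
  move=> _ [pi' hpi' <-]; rewrite (value_fix hpi fixV).
  by apply: value_le => // s'; exact: maxV.
split; last by apply: ge_sup => //; exists (value X pi s), pi.
by apply: ub_le_sup; [exists (value X pi s)|exists pi].
Qed.

End Value.

(** * Reduction to a start below its Bellman image *)

Lemma td_npg_shift (R : realType) (S A : finType) (M : mdp R S A) (eta : R)
    (pi0 : S -> A -> R) (V0 : S -> R) (c : R) k :
  (0 < #|A|)%N -> (forall s a, 0 < pi0 s a) ->
  td_npg M eta pi0 (fun s => V0 s - c) k =
  ((td_npg M eta pi0 V0 k).1,
   fun s => (td_npg M eta pi0 V0 k).2 s - discount M ^+ k * c).
Proof.
move=> hA pi0_gt0; elim: k => [|k IH].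
  by rewrite /= expr0; under [in RHS]eq_fun do rewrite mul1r.
have polE : (td_npg M eta pi0 (fun s => V0 s - c) k.+1).1 =
    (td_npg M eta pi0 V0 k.+1).1.
  rewrite !td_npg_policyS IH /= -[RHS](npg_update_shift _ _ _
    (fun=> discount M * (discount M ^+ k * c))).
  congr npg_update; apply/funext => s; apply/funext => a.
  by rewrite qvalue_shift.
have : is_policy (td_npg M eta pi0 V0 k.+1).1.
  by rewrite td_npg_policyS; apply: npg_update_policy => //; exact: td_npg_gt0.
rewrite [LHS]surjective_pairing !td_npg_valE polE IH.
set pol := (td_npg M eta pi0 V0 k.+1).1 => pol_policy.
congr pair; apply/funext => s /=.
by rewrite bellman_shift // exprS mulrA.
Qed.

Theorem theorem3p11 (R : realType) (S A : finType)
    (hS : (0 < #|S|)%N) (hA : (0 < #|A|)%N) (M : mdp R S A)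
    (X : forall (pi : S -> A -> R) (s : S), rollout M pi s)
    (eta : R) (heta : 0 < eta)
    (V0 : S -> R) (pi0 : S -> A -> R)
    (hpi0 : is_policy pi0) (hpos : forall s a, 0 < pi0 s a) :
  exists pistar : S -> A -> R,
    optimal X pistar /\
    forall s a, (fun k : nat => (td_npg M eta pi0 V0 k).1 s a) @ \oo
                  --> pistar s a.
Proof.
(* Lowering V^0 by c lowers V^0 - T V^0 by (1 - gamma) c, here the sum of all the absolute residuals
   and hence at least each of them. *)
pose c := \sum_s `|V0 s - bellman M pi0 V0 s| / (1 - discount M).
pose W s := V0 s - c.
have g1 : 0 < 1 - discount M by rewrite subr_gt0 discount_lt1.
have W_le s : W s <= bellman M pi0 W s.
  rewrite bellman_shift //.
  suff : V0 s - bellman M pi0 V0 s <= c * (1 - discount M).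
    by rewrite /W; lra.
  rewrite /c -mulr_suml divfK ?gt_eqF //.
  apply: le_trans (ler_norm _) _.
  by rewrite (bigD1 s) //= lerDl sumr_ge0.
have [best bestP] := best_exists M eta hA pi0 W.
have [pistar [hstar cv fixV maxV]] :=
  td_npg_cvg_greedy hA heta hpi0 hpos W_le bestP.
exists pistar; split; first exact: bellman_optimal fixV maxV.
move=> s a; have := cv s a.
(* The runs from [W] and from [V0] have the same policies. *)
by under eq_fun do rewrite (td_npg_shift _ _ _ _ _ hA hpos) /=.
Qed.
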